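(* Let $p,q,r$ be positive integers with $p > qr$ and $qr$ not dividing $p$. Then the $\mathrm{LS}_+$-rank of $\mathrm{MT}_r(K_p^q)$ is $\lfloor \frac{p}{qr} \rfloor$.
   Context: $K_p^q$ is the complete $q$-uniform hypergraph on vertex set $[p]$ (all $q$-subsets are hyperedges). For a $q$-uniform hypergraph $G$, $E_r(G)$ is the set of $r$-matchings: sets of $r$ pairwise disjoint hyperedges; an $r$-matching $S$ saturates vertex $i$ if $i$ lies in some hyperedge of $S$. $\mathrm{MT}_r(G) := \{x \in [0,1]^{E_r(G)} : \sum_{S \in E_r(G),\ S \text{ saturates } i} x_S \le 1 \ \forall i \in V(G)\}$. For $P \subseteq [0,1]^n$: $P_I := \mathrm{conv}(P \cap \{0,1\}^n)$; $K(P) := \{(\lambda,\lambda x) : \lambda \ge 0, x \in P\}$; $\mathrm{LS}_+(P)$ is the set of $x\in\mathbb{R}^n$ for which there is a symmetric $(n+1)\times(n+1)$ matrix $Y$ (indexed by $0,1,\dots,n$) with $Ye_0 = \mathrm{diag}(Y) = (1,x)$, $Ye_i \in K(P)$ and $Y(e_0-e_i) \in K(P)$ for all $i \in [n]$, and $Y \succeq 0$. $\mathrm{LS}_+^k$ denotes $k$ successive applications ($\mathrm{LS}_+^0(P) = P$), and the $\mathrm{LS}_+$-rank of $P$ is the smallest $k$ with $\mathrm{LS}_+^k(P) = P_I$. *)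

(* Defs.v *)
From HB Require Import structures.
From mathcomp Require Import all_boot all_order all_algebra.
From mathcomp Require Import boolp classical_sets reals.

Set Implicit Arguments.
Unset Strict Implicit.
Unset Printing Implicit Defensive.

Import Order.TTheory GRing.Theory Num.Theory.

Local Open Scope classical_set_scope.
Local Open Scope ring_scope.

(* A hypergraph on the finite vertex type V is given by its set of hyperedges
   G : {set {set V}}; every element of V is a vertex. *)

Definition complete_uniform (p q : nat) : {set {set 'I_p}} :=
  [set e : {set 'I_p} | #|e| == q].

Definition matchings (V : finType) (G : {set {set V}}) (r : nat) :
    {set {set {set V}}} :=
  [set S : {set {set V}} | [&& S \subset G, #|S| == r & finset.trivIset S]].

Definition saturates (V : finType) (S : {set {set V}}) (i : V) : bool :=
  [exists e in S, i \in e].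

Section Polytopes.

Variable R : realType.

(* The coordinate s : 'I_#|matchings G r| stands for the matching enum_val s. *)
Definition MT (V : finType) (G : {set {set V}}) (r : nat) :
    set 'cV[R]_#|matchings G r| :=
  [set x : 'cV[R]_(#|matchings G r|) | (forall s, 0 <= x s 0 <= 1) /\
           (forall i : V, \sum_(s | saturates (enum_val s) i) x s 0 <= 1)].

Definition conv (n : nat) (A : set 'cV[R]_n) : set 'cV[R]_n :=
  [set x : 'cV[R]_n | exists (m : nat) (a : 'I_m -> R) (y : 'I_m -> 'cV[R]_n),
     [/\ forall j, 0 <= a j, \sum_j a j = 1, forall j, A (y j) &
         x = \sum_j a j *: y j]].

Definition integer_hull (n : nat) (P : set 'cV[R]_n) : set 'cV[R]_n :=
  conv (P `&` [set x : 'cV[R]_n | forall i, x i 0 = 0 \/ x i 0 = 1]).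

(* Vectors of R^(n+1) indexed by 0, 1, ..., n have type 'cV[R]_(1 + n): the
   coordinate 0 is lshift n 0, and i : 'I_n becomes rshift 1 i. *)
Definition homog (n : nat) (a : R) (x : 'cV[R]_n) : 'cV[R]_(1 + n) :=
  col_mx a%:M x.

Definition unit0 (n : nat) : 'cV[R]_(1 + n) := delta_mx (lshift n 0) 0.

Definition uniti (n : nat) (i : 'I_n) : 'cV[R]_(1 + n) :=
  delta_mx (rshift 1 i) 0.

Definition Kcone (n : nat) (P : set 'cV[R]_n) : set 'cV[R]_(1 + n) :=
  [set z : 'cV[R]_(1 + n) | exists (a : R) (x : 'cV[R]_n),
     [/\ 0 <= a, P x & z = homog a (a *: x)]].

Definition psd (m : nat) (Y : 'M[R]_m) : Prop :=
  forall v : 'cV[R]_m, 0 <= (v^T *m Y *m v) 0 0.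

Definition LSp (n : nat) (P : set 'cV[R]_n) : set 'cV[R]_n :=
  [set x : 'cV[R]_n | exists Y : 'M[R]_(1 + n),
     [/\ Y^T = Y,
         Y *m unit0 n = homog 1 x /\ \col_j Y j j = homog 1 x,
         forall i : 'I_n, Kcone P (Y *m uniti i) /\
                          Kcone P (Y *m (unit0 n - uniti i)) &
         psd Y]].

Definition is_LSp_rank (n : nat) (P : set 'cV[R]_n) (k : nat) : Prop :=
  iter k (@LSp n) P = integer_hull P /\
  forall j : nat, iter j (@LSp n) P = integer_hull P -> (k <= j)%N.

End Polytopes.

Arguments MT R {V} G r _.

(* Main.v *)
Require Import Defs.
From mathcomp Require Import all_boot all_order all_algebra reals.
From mathcomp Require Import perm boolp.
From mathcomp Require Import ring lra zify.

(* Put m = qr. An r-matching S only matters through the m-set of vertices it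
   saturates, and every m-set is saturated by the same number of r-matchings, so
   MT_r(K_p^q) is the fractional packing polytope of the m-sets of [p] with
   constant multiplicities.

   Upper bound. If the coordinates of x in LS_+^j are 1 on a packing M leaving
   fewer than (j+1)m vertices uncovered, then every nonnegative inequality valid
   for the packings containing M holds at x: positive semidefiniteness reduces
   the claim to the points Y e_i / x_i, for which i joins M and j decreases. For
   j = floor(p/m) and M empty, Farkas' lemma puts x in the integer hull.

   Lower bound. The point that is 1 on a packing M and uniform on the edges in
   the uncovered set W, with vertex sums 1, lies in LS_+^j as soon as
   #|W| >= (j+1)m: the columns of its matrix are points of the same kind with one
   more edge in M, and Y (e_0 - e_s) is a sum of columns since all vertex sums
   are 1. Positive semidefiniteness is exactly the bound -C(w-m-1, m-1) for the
   least eigenvalue of the Kneser graph of the m-subsets of a w-set, which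
   follows from a path-coupling contraction estimate. With M empty, the
   coordinate sum is p/m, above floor(p/m), so the point is not in the integer
   hull. *)

Set Implicit Arguments.
Unset Strict Implicit.
Unset Printing Implicit Defensive.

Import Order.TTheory GRing.Theory Num.Theory.

Local Open Scope ring_scope.

(** * Farkas' lemma and growth of log-convex sequences *)

(* Induction on k: if y0 separates b from the first k generators, then
   projecting along a k onto the kernel of y0 removes the generator a k. *)
Lemma farkas (R : realFieldType) d k (a : nat -> 'cV[R]_d) (b : 'cV[R]_d) :
    (forall y : 'rV[R]_d, (forall j, (j < k)%N -> 0 <= (y *m a j) 0 0) ->
       0 <= (y *m b) 0 0) ->
  exists2 c : nat -> R, forall j, 0 <= c j & b = \sum_(j < k) c j *: a j.
Proof.
elim: k a b => [|k IH] a b hb.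
  exists (fun=> 0) => //; rewrite big_ord0; apply/colP => i; rewrite mxE.
  have row_b (j : R) : (j *: delta_mx 0 i *m b) 0 0 = j * b i 0.
    rewrite -scalemxAl !mxE (bigD1 i) //= big1 => [|l li]; rewrite !mxE.
      by rewrite !eqxx mul1r addr0.
    by rewrite (negPf li) andbF mul0r.
  have := hb (1 *: delta_mx 0 i) (fun j h => ltac:(by [])).
  have := hb (-1 *: delta_mx 0 i) (fun j h => ltac:(by [])).
  by rewrite !row_b; lra.
have [hk|] := pselect (forall y : 'rV[R]_d,
    (forall j, (j < k)%N -> 0 <= (y *m a j) 0 0) -> 0 <= (y *m b) 0 0).
  have [c c0 ->] := IH a b hk.
  exists (fun j => if (j < k)%N then c j else 0); first by move=> j; case: ifP.
  rewrite big_ord_recr /= ltnn scale0r addr0.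
  by apply: eq_bigr => j _; rewrite ltn_ord.
move=> /existsNP[y0] /not_implyP[y0a /negP]; rewrite -ltNge => y0b.
have y0k : (y0 *m a k) 0 0 < 0.
  rewrite ltNge; apply/negP => h; move: y0b; rewrite ltNge hb // => j.
  by rewrite ltnS leq_eqVlt => /orP[/eqP->|/y0a].
pose t (v : 'cV[R]_d) : R := (y0 *m v) 0 0 / (y0 *m a k) 0 0.
have entB (A B : 'M[R]_1) : (A - B) 0 0 = A 0 0 - B 0 0 by rewrite !mxE.
have entZ x (A : 'M[R]_1) : (x *: A) 0 0 = x * A 0 0 by rewrite mxE.
have [|c c0 hc] := IH (fun j => a j - t (a j) *: a k) (b - t b *: a k).
  (* The correction by a multiple of [y0] makes [y'] vanish on [a k] and agree with [y] on projected
     vectors, so the hypothesis on all [k.+1] generators applies to it. *)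
  move=> y hy; pose y' := y - ((y *m a k) 0 0 / (y0 *m a k) 0 0) *: y0.
  have y'E v : (y *m (v - t v *: a k)) 0 0 = (y' *m v) 0 0.
    rewrite mulmxBr mulmxBl -scalemxAr -scalemxAl !entB !entZ /t; field.
    by rewrite lt_eqF.
  rewrite y'E; apply: hb => j; rewrite ltnS leq_eqVlt => /orP[/eqP->|jk].
    suff -> : (y' *m a k) 0 0 = 0 by [].
    by rewrite mulmxBl -scalemxAl entB entZ divfK ?subrr // lt_eqF.
  by rewrite -y'E hy.
(* The coefficient of [a k] collects what the projections removed. It is nonnegative because
   [t b > 0] while [t (a i) <= 0] for [i < k]. *)
exists (fun j => if (j < k)%N then c j else t b - \sum_(i < k) c i * t (a i)).
  move=> j; case: ifP => // _; rewrite subr_ge0.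
  apply: (@le_trans _ _ 0).
    apply: sumr_le0 => i _; apply: mulr_ge0_le0 => //.
    by rewrite mulr_ge0_le0 ?y0a // invr_le0 ltW.
  by rewrite /t ltW // nmulr_rgt0 // invr_lt0.
rewrite big_ord_recr /= ltnn -[LHS](subrK (t b *: a k)) hc scalerBl addrCA addrC.
congr (_ + _).
transitivity (\sum_(j < k) c j *: a j - \sum_(i < k) (c i * t (a i)) *: a k).
  by rewrite -sumrB; apply: eq_bigr => j _; rewrite scalerBr scalerA.
rewrite -scaler_suml; congr (_ - _).
by apply: eq_bigr => j _; rewrite ltn_ord.
Qed.

Lemma cauchy_schwarz (R : realFieldType) (I : finType) (P : pred I) (f g : I -> R) :
  (\sum_(i | P i) f i * g i) ^+ 2 <=
  (\sum_(i | P i) f i ^+ 2) * (\sum_(i | P i) g i ^+ 2).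
Proof.
set A := \sum_(i | P i) f i ^+ 2; set B := \sum_(i | P i) _ * _.
set C := \sum_(i | P i) g i ^+ 2.
have A0 : 0 <= A by apply: sumr_ge0 => i _; apply: sqr_ge0.
have [A00|A_neq0] := eqVneq A 0.
  suff -> : B = 0 by rewrite A00 mul0r expr0n.
  apply: big1 => i Pi; suff -> : f i = 0 by rewrite mul0r.
  apply/eqP; rewrite -sqrf_eq0; move/eqP: A00.
  by rewrite psumr_eq0 => [/allP/(_ i (mem_index_enum i))/implyP/(_ Pi)|j _]; rewrite ?sqr_ge0.
have : 0 <= \sum_(i | P i) (A * g i - B * f i) ^+ 2.
  by apply: sumr_ge0 => i _; apply: sqr_ge0.
suff -> : \sum_(i | P i) (A * g i - B * f i) ^+ 2 = A * (A * C - B ^+ 2).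
  by rewrite pmulr_rge0 ?subr_ge0 // lt_neqAle eq_sym A_neq0.
transitivity (\sum_(i | P i) (A ^+ 2 * g i ^+ 2 - (A * B *+ 2) * (f i * g i)
  + B ^+ 2 * f i ^+ 2)); first by apply: eq_bigr => i _; ring.
by rewrite big_split sumrB /= -!mulr_sumr -/A -/B -/C; ring.
Qed.

(** If [a 1 > g * a 0], then [a 0 > 0] and log-convexity keeps every successive ratio at least
    [K = a 1 / a 0 > g]. Hence [a k] is at least [K ^+ k * a 0], which outruns [B * g ^+ k] by
    Bernoulli's inequality. *)
Lemma logconvex_growth (R : archiRealFieldType) (a : nat -> R) (B g : R) :
    (forall k, 0 <= a k) -> 0 < g ->
    (forall k, a k.+1 ^+ 2 <= a k * a k.+2) ->
    (forall k, a k <= B * g ^+ k) ->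
  a 1%N <= g * a 0%N.
Proof.
move=> a_ge0 g_gt0 a_conv a_le; rewrite leNgt; apply/negP => a1.
have a0 : 0 < a 0%N.
  rewrite lt_neqAle a_ge0 andbT; apply/negP => /eqP a00.
  have := a_conv 0%N; rewrite -a00 mul0r exprn_even_le0 //= => /eqP a10.
  by rewrite a10 -a00 mulr0 ltxx in a1.
pose K := a 1%N / a 0%N.
have K_gt0 : 0 < K by rewrite divr_gt0 // (le_lt_trans _ a1) // mulr_ge0 // ltW.
have aS k : 0 < a k /\ K * a k <= a k.+1.
  elim: k => [|k [ak IH]]; first by rewrite a0 divfK ?lexx // gt_eqF.
  have ak1 : 0 < a k.+1 by apply: lt_le_trans IH; rewrite mulr_gt0.
  split=> //; rewrite -(ler_pM2l ak); apply: le_trans (a_conv k).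
  by rewrite expr2 mulrCA mulrA ler_pM2r.
have aK k : K ^+ k * a 0%N <= a k.
  elim: k => [|k IH]; first by rewrite expr0 mul1r.
  by rewrite exprS -mulrA (le_trans _ (aS k).2) // ler_pM2l.
pose d := K / g - 1.
have d_gt0 : 0 < d by rewrite subr_gt0 ltr_pdivlMr // mul1r ltr_pdivlMr.
have bern k : 1 + k%:R * d <= (K / g) ^+ k.
  elim: k => [|k IH]; first by rewrite mul0r addr0.
  rewrite exprS (_ : K / g = 1 + d) in IH *; last by rewrite addrC subrK.
  apply: (@le_trans _ _ ((1 + d) * (1 + k%:R * d))).
    rewrite -natr1; have : 0 <= k%:R * d * d :> R by rewrite !mulr_ge0 // ltW.
    nra.
  by rewrite ler_pM2l // addr_gt0.
have bound k : k%:R * (d * a 0%N) <= B.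
  have : (K / g) ^+ k * a 0%N <= B.
    rewrite expr_div_n mulrAC ler_pdivrMr ?exprn_gt0 //.
    exact: le_trans (aK k) (a_le k).
  apply: le_trans; rewrite mulrA ler_pM2r // (le_trans _ (bern k)) //.
  by rewrite lerDr.
have da : 0 < d * a 0%N by rewrite mulr_gt0.
have B0 : 0 <= B / (d * a 0%N).
  by apply: divr_ge0; [have := bound 0%N; rewrite mul0r | exact: ltW].
have := archi_boundP B0; rewrite ltr_pdivrMr //.
by rewrite ltNge bound.
Qed.

(** * The least eigenvalue of the Kneser graph *)

Lemma card_draws_mem (V : finType) (A : {set V}) (k : nat) (b : V) :
    b \in A -> (0 < k)%N ->
  #|[set S : {set V} | [&& S \subset A, #|S| == k & b \in S]]| =
  'C(#|A|.-1, k.-1).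
Proof.
move=> bA; case: k => // k _ /=.
have := cards_draws A k.+1.
set D := [set S : {set V} | S \subset A & _]; rewrite -(cardsID [set S : {set V} | b \in S] D).
have -> : D :\: [set S : {set V} | b \in S] =
    [set S : {set V} | (S \subset A :\ b) & #|S| == k.+1].
  by apply/setP => S; rewrite !inE subsetD1; case: (b \in S); rewrite ?andbF ?andbT.
rewrite cards_draws (cardsD1 b A) bA add1n /= binS addnC => /addnI <-.
by apply: eq_card => S; rewrite !inE andbA.
Qed.

Lemma exists_draw (V : finType) (T : {set V}) k : (k <= #|T|)%N ->
  exists2 e : {set V}, e \subset T & #|e| = k.
Proof.
rewrite -bin_gt0 -cards_draws => /card_gt0P[e]; rewrite inE => /andP[eT /eqP ek].
by exists e.
Qed.

Section Kneser.

Variables (R : archiRealFieldType) (V : finType) (m : nat) (W : {set V}).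

Definition slice : pred {set V} := [pred T : {set V} | (T \subset W) && (#|T| == m)].

Definition swap (T : {set V}) (a b : V) : {set V} := b |: (T :\ a).

Lemma slice_swap (T : {set V}) a b : a \in T -> b \in W -> b \notin T ->
  slice T -> slice (swap T a b).
Proof.
move=> aT bW bT /andP[TW /eqP Tm]; rewrite /slice inE subUset sub1set bW /=.
rewrite (subset_trans (subD1set _ _) TW) /= cardsU1 !inE (negPf bT) andbF /=.
by rewrite -Tm (cardsD1 a T) aT.
Qed.

(** This is the Lipschitz condition for the Johnson graph on the [m]-subsets of [W], tested on its
    edges only. *)
Definition swap_lipschitz (L : R) (h : {set V} -> R) :=
  forall (T : {set V}) a b, slice T -> a \in T -> b \in W -> b \notin T ->
    `|h T - h (swap T a b)| <= L.

(** Swapping an element of [T :\: T'] for one of [T' :\: T] stays in the slice and shrinks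
    [T :\: T'] by one, so a path of [#|T :\: T'|] swaps leads from [T] to [T']. *)
Lemma swap_lipschitz_dist L h T T' : swap_lipschitz L h ->
  slice T -> slice T' -> `|h T - h T'| <= #|T :\: T'|%:R * L.
Proof.
move=> hL; move n_def: #|_| => n; elim: n T n_def => [|n IH] T TT' XT XT'.
  have /eqP : T == T'.
    rewrite eqEcard -setD_eq0 -cards_eq0 TT' /=.
    by move: XT XT' => /andP[_ /eqP->] /andP[_ /eqP->].
  by move=> ->; rewrite subrr normr0 mul0r.
have /set0Pn[a] : T :\: T' != set0 by rewrite -cards_eq0 TT'.
rewrite inE => /andP[aT' aT].
have /set0Pn[b] : T' :\: T != set0.
  rewrite -cards_eq0; suff -> : #|T' :\: T| = #|T :\: T'| by rewrite TT'.
  apply/eqP; rewrite -(eqn_add2l #|T' :&: T|) cardsID setIC cardsID.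
  by move: XT XT' => /andP[_ /eqP->] /andP[_ /eqP->].
rewrite inE => /andP[bT bT'].
have bW : b \in W by case/andP: XT' => /subsetP T'W _; apply: T'W.
have swapD : swap T a b :\: T' = (T :\: T') :\ a.
  apply/setP => x; rewrite !inE; have [->|_] := eqVneq x b.
    by rewrite bT' (negPf bT) !andbF.
  by rewrite /= andbCA.
rewrite -[X in X - _](subrK (h (swap T a b))) -addrA -natr1 mulrDl mul1r addrC.
apply: le_trans (ler_normD _ _) _; apply: lerD; last exact: hL.
apply: IH XT'; last exact: slice_swap.
apply/eqP; rewrite -(eqn_add2l 1) !add1n -TT' swapD [in X in _ == X](cardsD1 a).
by rewrite inE aT aT'.
Qed.

Definition kneser (h : {set V} -> R) (T : {set V}) : R :=
  \sum_(S | slice S && [disjoint S & T]) h S.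

Hypotheses (m_gt0 : (0 < m)%N) (Wm : (m.*2 <= #|W|)%N).

(** This is the number of Kneser neighbours of an [m]-set through a given point outside it; [- c] is
    the eigenvalue bound. *)
Let c := 'C((#|W| - m).-1, m.-1).

Lemma slice_cardD (T : {set V}) : slice T -> #|W :\: T| = (#|W| - m)%N.
Proof. by move=> /andP[TW /eqP Tm]; rewrite cardsDS // Tm. Qed.

Lemma swapK (T : {set V}) a b : a \in T -> b \notin T ->
  swap (swap T a b) b a = T.
Proof.
move=> aT bT; rewrite /swap setU1K ?setD1K //.
by rewrite !inE (negPf bT) andbF.
Qed.

(** These are the Kneser neighbours of [T] that are lost when [b] enters it. *)
Definition neighbour (T : {set V}) b : pred {set V} :=
  [pred S : {set V} | [&& slice S, [disjoint S & T] & b \in S]].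

Lemma neighbour_swap (T S : {set V}) a b : slice T -> a \in T -> b \notin T ->
  neighbour T b S -> neighbour (swap T a b) a (swap S b a).
Proof.
move=> /andP[TW _] aT bT /and3P[XS dS bS]; have aS := disjointFl dS aT.
apply/and3P; split.
- by apply: slice_swap => //; [apply: subsetP aT | rewrite aS].
- apply/pred0P => x /=; rewrite !inE; have [->|xa] := eqVneq x a.
    by rewrite /= orbF; apply: contraNF bT => /eqP <-.
  have [->|xb] := eqVneq x b; first by rewrite /=.
  rewrite /=; apply/negP => /andP[xS xT]; by rewrite (disjointFr dS xS) in xT.
- by rewrite !inE eqxx.
Qed.

(* Path coupling: after one swap in T only the neighbours containing the new
   element are lost, and the reverse swap matches them with those gained. *)
Lemma kneser_lipschitz L h :
  swap_lipschitz L h -> swap_lipschitz (c%:R * L) (kneser h).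
Proof.
move=> hL T a b XT aT bW bT; rewrite /kneser.
have XT2 := slice_swap aT bW bT XT.
have ab : a != b by apply: contraNneq bT => <-.
have aW : a \in W by case/andP: XT => /subsetP TW _; apply: TW.
have splitT (U : {set V}) x : \sum_(S | slice S && [disjoint S & U]) h S =
    \sum_(S | neighbour U x S) h S +
    \sum_(S | slice S && [disjoint S & x |: U]) h S.
  rewrite (bigID (fun S : {set V} => x \in S)) /=; congr (_ + _); apply: eq_bigl => S.
    by rewrite /neighbour /= andbA.
  rewrite -andbA; congr (_ && _).
  by rewrite -[in RHS]setI_eq0 setIUr setU_eq0 setIC !setI_eq0 disjoints1 andbC.
rewrite (splitT T b) (splitT (swap T a b) a).
(* The second sums of the two splittings both range over the sets disjoint from [b |: T], so they
   cancel. *)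
have -> : a |: swap T a b = b |: T by rewrite /swap setUCA setD1K.
rewrite opprD addrACA subrr addr0.
have -> : \sum_(S | neighbour (swap T a b) a S) h S =
    \sum_(S | neighbour T b S) h (swap S b a).
  have back S : neighbour (swap T a b) a S -> neighbour T b (swap S a b).
    move=> nS; rewrite -(swapK aT bT); apply: neighbour_swap => //.
      by rewrite !inE eqxx.
    by rewrite !inE eqxx (negPf ab).
  have bn S : neighbour (swap T a b) a S -> b \notin S.
    by case/and3P => _ dS _; rewrite (disjointFl dS) // !inE eqxx.
  rewrite (reindex_onto (fun S => swap S b a) (fun S => swap S a b)) /=.
    apply: eq_bigl => S; apply/andP/idP => [[/back nS /eqP <-] //|nS].
    split; first exact: neighbour_swap.
    case/and3P: nS => _ dS bS.
    by rewrite swapK // (disjointFl dS).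
  by move=> S nS; rewrite swapK //; [case/and3P: nS | exact: bn].
rewrite -sumrB; apply: le_trans (ler_norm_sum _ _ _) _.
apply: (@le_trans _ _ (\sum_(S | neighbour T b S) L)).
  apply: ler_sum => S /and3P[XS dS bS]; apply: hL => //.
  by rewrite (disjointFl dS).
rewrite sumr_const.
suff -> : #|neighbour T b| = c by rewrite mulr_natl lexx.
rewrite /c -(slice_cardD XT) -(@card_draws_mem _ _ _ b) ?inE ?bT //.
by apply: eq_card => S; rewrite !inE subsetD /slice /= -!andbA; do !bool_congr.
Qed.

Definition kdot (f h : {set V} -> R) : R := \sum_(T | slice T) f T * h T.

Lemma kneser_sym f h : kdot f (kneser h) = kdot (kneser f) h.
Proof.
rewrite /kdot /kneser.
under eq_bigr => T _ do rewrite mulr_sumr big_mkcondr.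
rewrite exchange_big /=; apply: eq_bigr => S _.
rewrite mulr_suml [RHS]big_mkcondr /=.
by apply: eq_bigr => T _; rewrite disjoint_sym.
Qed.

Lemma kneser_const x T : slice T ->
  kneser (fun=> x) T = 'C(#|W| - m, m)%:R * x.
Proof.
move=> XT; rewrite /kneser sumr_const mulr_natl; congr (_ *+ _).
rewrite -(slice_cardD XT) -cards_draws.
by apply: eq_card => S; rewrite !inE subsetD andbAC.
Qed.

Lemma kdot_cauchy_schwarz f h : kdot f h ^+ 2 <= kdot f f * kdot h h.
Proof. exact: cauchy_schwarz. Qed.

Lemma kdot_ge0 f : 0 <= kdot f f.
Proof. by apply: sumr_ge0 => T _; rewrite -expr2 sqr_ge0. Qed.

Let c_gt0 : 0 < c%:R :> R.
Proof. rewrite ltr0n bin_gt0; lia. Qed.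

(* Power method: the k-th iterate of h keeps mean zero and has swap-Lipschitz
   constant O(c^k), hence norm O(c^k); as these norms are log-convex in k, the
   first step expands by at most c. *)
Lemma kneser_norm (h : {set V} -> R) : \sum_(T | slice T) h T = 0 ->
  kdot (kneser h) (kneser h) <= c%:R ^+ 2 * kdot h h.
Proof.
move=> h0; pose D k := iter k kneser h.
have D0 k : \sum_(T | slice T) D k T = 0.
  elim: k => [|k IH] //=.
  transitivity (kdot (fun=> 1) (kneser (D k))).
    by apply: eq_bigr => T _; rewrite mul1r.
  rewrite kneser_sym /kdot.
  under eq_bigr => T XT do rewrite kneser_const // mulr1.
  by rewrite -mulr_sumr IH mulr0.
(* Twice the l1 norm of [h] bounds every difference of two of its values. *)
pose L := \sum_(T | slice T) `|h T| *+ 2.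
have DL k : swap_lipschitz (c%:R ^+ k * L) (D k).
  elim: k => [|k IH] /=; last by rewrite exprS -mulrA; apply: kneser_lipschitz.
  have hle T : slice T -> `|h T| <= \sum_(T | slice T) `|h T|.
    by move=> XT; rewrite (bigD1 T) //= lerDl sumr_ge0.
  move=> T a b XT aT bW bT; rewrite expr0 mul1r (le_trans (ler_normB _ _)) //.
  by rewrite /L sumrMnl mulr2n lerD ?hle ?slice_swap.
have L0 : 0 <= L by rewrite sumr_ge0 // => T _; rewrite mulrn_wge0.
(* Since [D k] has mean zero, [n * D k T] is the sum of the differences [D k T - D k T'], and two
   [m]-sets are at most [m] swaps apart. *)
have Dle k T : slice T -> `|D k T| <= m%:R * (c%:R ^+ k * L).
  move=> XT; pose n : R := \sum_(T' | slice T') 1.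
  have n_gt0 : 0 < n.
    by rewrite /n (bigD1 T) //= ltr_pwDl // sumr_ge0.
  rewrite -(ler_pM2l n_gt0) -[X in X * _]gtr0_norm // -normrM.
  have -> : n * D k T = \sum_(T' | slice T') (D k T - D k T').
    by rewrite sumrB D0 subr0 /n mulr_suml; apply: eq_bigr => *; rewrite mul1r.
  apply: le_trans (ler_norm_sum _ _ _) _; rewrite /n mulr_suml.
  apply: ler_sum => T' XT'; rewrite mul1r.
  apply: le_trans (swap_lipschitz_dist (DL k) XT XT') _.
  rewrite ler_wpM2r ?mulr_ge0 ?exprn_ge0 // ler_nat.
  by case/andP: XT => _ /eqP <-; apply/subset_leq_card/subsetDl.
pose a k := kdot (D k) (D k).
apply: (@logconvex_growth _ a (\sum_(T | slice T) (m%:R * L) ^+ 2)).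
- by move=> k; apply: kdot_ge0.
- by rewrite exprn_gt0.
(* Self-adjointness turns [a k.+1] into the product of [D k] with [D k.+2]; Cauchy-Schwarz then
   gives log-convexity. *)
- by move=> k; rewrite /a {1}/kdot /= -/(kdot _ _) -kneser_sym; apply: kdot_cauchy_schwarz.
- move=> k; rewrite /a /kdot mulr_suml; apply: ler_sum => T XT.
  rewrite -expr2 -real_normK ?num_real // -exprM mulnC exprM -exprMn.
  rewrite lerXn2r ?nnegrE ?mulr_ge0 ?exprn_ge0 //.
  by apply: le_trans (Dle k T XT) _; rewrite mulrCA mulrC.
Qed.

(** Split [h] into its mean and a mean-zero part [g]. The operator respects this splitting, as the
    Kneser graph is regular. Constants have the nonnegative eigenvalue ['C(#|W| - m, m)], and on [g]
    the operator has norm at most [c]. *)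
Lemma kneser_psd (h : {set V} -> R) : 0 <= c%:R * kdot h h + kdot h (kneser h).
Proof.
pose n : R := \sum_(T | slice T) 1.
have n_ge0 : 0 <= n by rewrite sumr_ge0.
pose mu := (\sum_(T | slice T) h T) / n.
have mun : mu * n = \sum_(T | slice T) h T.
  have [n0|n0] := eqVneq n 0; last by rewrite divfK.
  rewrite n0 mulr0 big_pred0 // => T; apply/negP => XT.
  by move: n0; rewrite /n (bigD1 T) //= => /eqP; rewrite gt_eqF // ltr_pwDl // sumr_ge0.
pose g T := h T - mu.
have g0 : \sum_(T | slice T) g T = 0.
  rewrite sumrB -mun /n mulr_sumr.
  by apply/eqP; rewrite subr_eq0; apply/eqP/eq_bigr => *; rewrite mulr1.
have hh : kdot h h = kdot g g + mu ^+ 2 * n.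
  transitivity (\sum_(T | slice T) (g T * g T + (mu *+ 2) * g T + mu ^+ 2)).
    by apply: eq_bigr => T _; rewrite /g; ring.
  rewrite !big_split /= -mulr_sumr g0 mulr0 addr0 /n mulr_sumr.
  by congr (_ + _); apply: eq_bigr => *; rewrite mulr1.
have hKh : kdot h (kneser h) = kdot g (kneser g) + 'C(#|W| - m, m)%:R * (mu ^+ 2 * n).
  have Kh T : slice T -> kneser h T = kneser g T + 'C(#|W| - m, m)%:R * mu.
    move=> XT; rewrite -(kneser_const _ XT) /kneser -big_split /=.
    by apply: eq_bigr => S _; rewrite /g subrK.
  have Kg : \sum_(T | slice T) kneser g T = 0.
    transitivity (kdot (fun=> 1) (kneser g)).
      by apply: eq_bigr => T _; rewrite mul1r.
    rewrite kneser_sym /kdot.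
    under eq_bigr => T XT do rewrite kneser_const // mulr1.
    by rewrite -mulr_sumr g0 mulr0.
  transitivity (\sum_(T | slice T) (g T * kneser g T + mu * kneser g T +
      'C(#|W| - m, m)%:R * mu * g T + 'C(#|W| - m, m)%:R * (mu ^+ 2 * 1))).
    by apply: eq_bigr => T XT; rewrite Kh // /g; ring.
  by rewrite !big_split /= -!mulr_sumr g0 Kg !mulr0 !addr0.
rewrite hh hKh.
have : 0 <= c%:R * kdot g g + kdot g (kneser g).
  have gg := kdot_ge0 g.
  have cgg : 0 <= c%:R * kdot g g by rewrite mulr_ge0.
  suff : `|kdot g (kneser g)| <= c%:R * kdot g g by rewrite ler_norml; lra.
  rewrite -(ler_pXn2r (n := 2)) ?nnegrE // real_normK ?num_real //.
  apply: le_trans (kdot_cauchy_schwarz _ _) _.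
  apply: le_trans (ler_wpM2l gg (kneser_norm g0)) _.
  by rewrite exprMn mulrCA -expr2.
have : 0 <= c%:R * (mu ^+ 2 * n) by rewrite mulr_ge0 // mulr_ge0 // sqr_ge0.
have : 0 <= 'C(#|W| - m, m)%:R * (mu ^+ 2 * n) by rewrite mulr_ge0 // mulr_ge0 // sqr_ge0.
by rewrite mulrDr; lra.
Qed.

End Kneser.

(** * The Lovasz-Schrijver operator *)

Section LovaszSchrijver.

Variables (R : realType) (n : nat).

Implicit Types (P : classical_sets.set 'cV[R]_n) (x y : 'cV[R]_n).

Lemma homog_inj (a b : R) x y : homog a x = homog b y -> a = b /\ x = y.
Proof.
by move=> /eq_col_mx[/matrixP/(_ 0 0)]; rewrite !mxE !eqxx !mulr1n.
Qed.

Lemma homogD (a b : R) x y : homog (a + b) (x + y) = homog a x + homog b y.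
Proof. by rewrite /homog raddfD /= add_col_mx. Qed.

Lemma homogZ (a b : R) x : homog (a * b) (a *: x) = a *: homog b x.
Proof. by rewrite /homog scale_col_mx scale_scalar_mx. Qed.

Lemma homog0 : homog 0 (0 : 'cV[R]_n) = 0.
Proof. by rewrite /homog raddf0 col_mx0. Qed.

Lemma Kcone_homogP P (a : R) x : Kcone P (homog a x) <->
  0 <= a /\ exists2 y, P y & x = a *: y.
Proof.
split=> [[b [y [b0 Py /homog_inj[-> ->]]]]|[a0 [y Py ->]]].
  by split=> //; exists y.
by exists a, y.
Qed.

Lemma Kcone_homog1 P x : Kcone P (homog 1 x) <-> P x.
Proof.
rewrite Kcone_homogP; split=> [[_ [y Py ->]]|Px]; first by rewrite scale1r.
by split=> //; exists x => //; rewrite scale1r.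
Qed.

Lemma KconeZ P (a : R) z : 0 <= a -> Kcone P z -> Kcone P (a *: z).
Proof.
move=> a0 [b [y [b0 Py ->]]]; rewrite -homogZ scalerA.
by exists (a * b), y; rewrite mulr_ge0.
Qed.

Lemma Kcone0 P x : P x -> Kcone P 0.
Proof. by move=> Px; exists 0, x; rewrite scale0r homog0. Qed.

(* Additivity of K(P) is convexity of P. *)
Definition cone_convex P : Prop :=
  forall z1 z2, Kcone P z1 -> Kcone P z2 -> Kcone P (z1 + z2).

Lemma Kcone_sum P (I : finType) (A : pred I) (F : I -> 'cV[R]_(1 + n)) x :
    cone_convex P -> P x -> (forall i, A i -> Kcone P (F i)) ->
  Kcone P (\sum_(i | A i) F i).
Proof.
by move=> Pc Px FK; apply: big_ind => //; exact: Kcone0 Px.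
Qed.

Lemma conv_sub_convex P : cone_convex P -> forall x, conv P x -> P x.
Proof.
move=> Pc x [m [a [y [a0 a1 Py ->]]]].
case: m a y a0 a1 Py => [|m] a y a0 a1 Py.
  by move: a1 => /eqP; rewrite big_ord0 eq_sym oner_eq0.
apply/Kcone_homog1; rewrite -a1.
have -> : homog (\sum_j a j) (\sum_j a j *: y j) = \sum_j homog (a j) (a j *: y j).
  elim: (index_enum _) => [|j s IH]; first by rewrite !big_nil homog0.
  by rewrite !big_cons homogD IH.
apply: (Kcone_sum Pc (Py ord0)) => j _; apply/Kcone_homogP.
by split=> //; exists (y j).
Qed.

(** This is the quadratic form of the bordered matrix with blocks [1], [x^T], [x], [G] at the vector
    [(a, f)]. *)
Definition quad x (G : 'M[R]_n) (a : R) (f : 'I_n -> R) : R :=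
  a ^+ 2 + (a * \sum_i f i * x i 0) *+ 2 + \sum_i \sum_j f i * f j * G i j.

(** The border of [Y] is forced by [x] and symmetry, so only its lower right block [G] remains to be
    chosen. *)
Lemma LSpP P x : LSp P x <-> exists G : 'M[R]_n,
  [/\ forall i j, G i j = G j i, forall i, G i i = x i 0,
      forall i, Kcone P (homog (x i 0) (col i G)) /\
                Kcone P (homog (1 - x i 0) (x - col i G)) &
      forall a f, 0 <= quad x G a f].
Proof.
have unit0E : unit0 R n = col_mx 1%:M 0.
  apply/colP => i; rewrite !mxE; case: splitP => j ij; rewrite !mxE.
    by rewrite -(inj_eq val_inj) /= ij [j]ord1 eqxx.
  by rewrite -(inj_eq val_inj) /= ij.
have unitiE i : uniti R i = col_mx 0 (delta_mx i 0).
  apply/colP => k; rewrite !mxE; case: splitP => j kj; rewrite !mxE.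
    by rewrite -(inj_eq val_inj) /= kj [j]ord1.
  by rewrite -(inj_eq val_inj) /= kj eqn_add2l (inj_eq val_inj).
pose bl (G : 'M[R]_n) : 'M[R]_(1 + n) := block_mx 1%:M x^T x G.
have bl0 G : bl G *m unit0 R n = homog 1 x.
  by rewrite unit0E mul_block_col !mulmx1 !mulmx0 !addr0.
have bli G i : bl G *m uniti R i = homog (x i 0) (col i G).
  rewrite unitiE mul_block_col !mulmx0 !add0r -!colE; congr col_mx.
  by apply/colP => k; rewrite !mxE [k]ord1 eqxx mulr1n.
have bl0i G i : bl G *m (unit0 R n - uniti R i) = homog (1 - x i 0) (x - col i G).
  rewrite mulmxBr bl0 bli -[x - _]/(x + - _) homogD; congr (_ + _).
  by rewrite -[LHS]scaleN1r -homogZ mulN1r scaleN1r.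
have blq G a f : ((col_mx a%:M (\col_i f i))^T *m bl G *m
    col_mx a%:M (\col_i f i)) 0 0 = quad x G a f.
  rewrite tr_col_mx mul_row_block mul_row_col mxE !mulmxDl.
  rewrite tr_scalar_mx mulmx1 -scalar_mxM mul_mx_scalar mul_scalar_mx -scalemxAl.
  have fx : ((\col_i f i)^T *m x) 0 0 = \sum_i f i * x i 0.
    by rewrite mxE; apply: eq_bigr => i _; rewrite !mxE.
  have xf : (x^T *m \col_i f i) 0 0 = \sum_i f i * x i 0.
    by rewrite mxE; apply: eq_bigr => i _; rewrite !mxE mulrC.
  have fGf : ((\col_i f i)^T *m G *m \col_i f i) 0 0 =
      \sum_i \sum_j f i * f j * G i j.
    rewrite mxE exchange_big /=; apply: eq_bigr => j _.
    rewrite !mxE mulr_suml; apply: eq_bigr => i _.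
    by rewrite !mxE mulrAC.
  have entD (A B : 'M[R]_1) : (A + B) 0 0 = A 0 0 + B 0 0 by rewrite mxE.
  have entZ b (A : 'M[R]_1) : (b *: A) 0 0 = b * A 0 0 by rewrite mxE.
  rewrite !entD !entZ fx xf fGf mxE eqxx mulr1n /quad; ring.
split=> [[Y [Ysym [Y0 Yd] YK Ypsd]]|[G [Gsym Gd GK Gq]]].
  pose G := drsubmx Y.
  have YE : Y = bl G.
    have col0 : col (lshift n 0) Y = homog 1 x by rewrite -Y0 colE.
    have Yl i : Y i (lshift n 0) = homog 1 x i 0 by rewrite -col0 mxE.
    rewrite -[Y]submxK /bl; congr block_mx.
    - by apply/matrixP => i j; rewrite [i]ord1 [j]ord1 mxE mxE Yl col_mxEu.
    - apply/matrixP => i j; rewrite [i]ord1 mxE mxE -Ysym mxE Yl.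
      by rewrite col_mxEd [RHS]mxE.
    - by apply/matrixP => i j; rewrite [j]ord1 mxE mxE Yl col_mxEd.
  exists G; split.
  - by move=> i j; rewrite !mxE -[in LHS]Ysym mxE.
  - move=> i; rewrite !mxE; move/colP/(_ (rshift 1 i)): Yd.
    by rewrite col_mxEd mxE.
  - by move=> i; move: (YK i); rewrite YE bli bl0i.
  - by move=> a f; rewrite -blq -YE.
exists (bl G); split.
- rewrite /bl tr_block_mx trmx1 trmxK; congr block_mx.
  by apply/matrixP => i j; rewrite mxE Gsym.
- split=> //; apply/colP => i; rewrite mxE.
  case: (split_ordP i) => j ->; first by rewrite block_mxEul col_mxEu [j]ord1.
  by rewrite block_mxEdr col_mxEd Gd.
- by move=> i; rewrite bli bl0i.
- move=> v; rewrite -[v]vsubmxK.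
  have -> : usubmx v = (usubmx v 0 0)%:M by rewrite -mx11_scalar.
  have -> : dsubmx v = \col_i (dsubmx v i 0).
    by apply/colP => i; rewrite [RHS]mxE.
  by rewrite blq.
Qed.

(** The conditions on the pair [(x, G)] are linear, apart from the cone conditions, which are
    preserved because [P] is convex. Hence the witnesses combine with the normalised weights [s] and
    [t]. *)
Lemma LSp_convex P : cone_convex P -> cone_convex (LSp P).
Proof.
move=> Pc z1 z2 [a [x [a0 LSx ->]]] [b [y [b0 LSy ->]]].
rewrite -homogD; have [ab0|ab0] := eqVneq (a + b) 0.
  have a00 : a = 0 by lra.
  have b00 : b = 0 by lra.
  by rewrite a00 b00 !scale0r !addr0 homog0; apply: Kcone0 LSx.
have ab_gt0 : 0 < a + b by rewrite lt_neqAle eq_sym ab0 addr_ge0.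
pose s := a / (a + b); pose t := b / (a + b).
have s0 : 0 <= s by rewrite divr_ge0 // ltW.
have t0 : 0 <= t by rewrite divr_ge0 // ltW.
have st : s + t = 1 by rewrite -mulrDl divff.
have tE : t = 1 - s by rewrite -st addrC addKr.
apply/Kcone_homogP; split; first exact: ltW.
exists (s *: x + t *: y); last first.
  by rewrite scalerDr !scalerA ![(a + b) * _]mulrC !divfK.
move/LSpP: LSx => [G [Gsym Gd GK Gq]]; move/LSpP: LSy => [H [Hsym Hd HK Hq]].
apply/LSpP; exists (s *: G + t *: H); split.
- by move=> i j; rewrite !mxE Gsym Hsym.
- by move=> i; rewrite !mxE Gd Hd.
- move=> i; have [G1 G2] := GK i; have [H1 H2] := HK i; split.
    have -> : homog ((s *: x + t *: y) i 0) (col i (s *: G + t *: H)) =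
        s *: homog (x i 0) (col i G) + t *: homog (y i 0) (col i H).
      by rewrite -!homogZ -homogD !mxE; congr homog; apply/colP => k; rewrite !mxE.
    by apply: Pc; apply: KconeZ.
  have -> : homog (1 - (s *: x + t *: y) i 0)
        (s *: x + t *: y - col i (s *: G + t *: H)) =
      s *: homog (1 - x i 0) (x - col i G) + t *: homog (1 - y i 0) (y - col i H).
    rewrite -!homogZ -homogD !mxE; congr homog.
      by rewrite tE; ring.
    by apply/colP => k; rewrite !mxE; ring.
  by apply: Pc; apply: KconeZ.
- move=> c f.
  suff -> : quad (s *: x + t *: y) (s *: G + t *: H) c f =
      s * quad x G c f + t * quad y H c f by rewrite addr_ge0 // mulr_ge0.
  rewrite /quad.
  have -> : \sum_i f i * (s *: x + t *: y) i 0 =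
      s * \sum_i f i * x i 0 + t * \sum_i f i * y i 0.
    by rewrite !mulr_sumr -big_split; apply: eq_bigr => i _; rewrite !mxE /=; ring.
  have -> : \sum_i \sum_j f i * f j * (s *: G + t *: H) i j =
      s * (\sum_i \sum_j f i * f j * G i j) + t * \sum_i \sum_j f i * f j * H i j.
    rewrite !mulr_sumr -big_split; apply: eq_bigr => i _ /=.
    by rewrite !mulr_sumr -big_split; apply: eq_bigr => j _; rewrite !mxE /=; ring.
  by rewrite tE; ring.
Qed.

Lemma iter_LSp_convex P k : cone_convex P -> cone_convex (iter k (@LSp R n) P).
Proof. by move=> Pc; elim: k => // k; apply: LSp_convex. Qed.

(** The vector [homog 1 x] is the sum of [Y e_i] and [Y (e_0 - e_i)]. An index [i] is required,
    since for [n = 0] there are no column conditions. *)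
Lemma LSp_sub P x (i : 'I_n) : cone_convex P -> LSp P x -> P x.
Proof.
move=> Pc /LSpP[G [_ _ GK _]]; apply/Kcone_homog1; have [G1 G2] := GK i.
by have := Pc _ _ G1 G2; rewrite -homogD addrC subrK addrC subrK.
Qed.

Lemma iter_LSp_sub P x (i : 'I_n) k :
  cone_convex P -> iter k (@LSp R n) P x -> P x.
Proof.
move=> Pc; elim: k => //= k IH LSx; apply: IH; apply: LSp_sub LSx => //.
exact: iter_LSp_convex.
Qed.

(** The rank-one matrix [x x^T] is a witness: its diagonal is [x] because the entries are 0 or 1,
    and its columns are multiples of [x]. *)
Lemma LSp_integral P x : P x -> (forall i, x i 0 = 0 \/ x i 0 = 1) -> LSp P x.
Proof.
move=> Px x01; apply/LSpP; exists (\matrix_(i, j) (x i 0 * x j 0)); split.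
- by move=> i j; rewrite !mxE mulrC.
- by move=> i; rewrite mxE; case: (x01 i) => ->; rewrite ?mulr0 ?mulr1.
- have colx i : col i (\matrix_(i, j) (x i 0 * x j 0)) = x i 0 *: x.
    by apply/colP => j; rewrite !mxE mulrC.
  move=> i; rewrite colx.
  have -> : x - x i 0 *: x = (1 - x i 0) *: x by rewrite scalerBl scale1r.
  split; apply/Kcone_homogP; split; try by exists x.
    by case: (x01 i) => ->.
  by case: (x01 i) => ->; rewrite ?subr0 ?subrr.
- move=> a f; suff -> : quad x (\matrix_(i, j) (x i 0 * x j 0)) a f =
      (a + \sum_i f i * x i 0) ^+ 2 by apply: sqr_ge0.
  rewrite /quad sqrrD; congr (_ + _); rewrite expr2 mulr_suml.
  apply: eq_bigr => i _; rewrite mulr_sumr; apply: eq_bigr => j _.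
  by rewrite mxE; ring.
Qed.

(** Integral points of [P] survive every application, and every iterate is convex. *)
Lemma integer_hull_sub_LSp P k x : cone_convex P -> integer_hull P x ->
  iter k (@LSp R n) P x.
Proof.
move=> Pc [d [a [y [a0 a1 Py xE]]]]; apply: conv_sub_convex.
  exact: iter_LSp_convex.
exists d, a, y; split=> // j; have [Pyj y01] := Py j.
by elim: k => //= k IH; apply: LSp_integral.
Qed.

(* Column i of G is x_i y with y in P and y_i = 1, so a^T G a <= b (a^T x),
   while positive semidefiniteness gives (a^T x)^2 <= a^T G a. *)
Lemma LSp_valid P x (a : 'I_n -> R) (b : R) : LSp P x ->
    (forall i, 0 <= x i 0) -> (forall i, 0 <= a i) -> 0 <= b ->
    (forall i y, a i != 0 -> 0 < x i 0 -> P y -> y i 0 = 1 ->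
       (forall j, x j 0 = 1 -> y j 0 = 1) -> \sum_j a j * y j 0 <= b) ->
  \sum_j a j * x j 0 <= b.
Proof.
move=> /LSpP[G [Gsym Gd GK Gq]] x0 a0 b0 hval; set t := \sum_j _.
have t0 : 0 <= t by apply: sumr_ge0 => j _; rewrite mulr_ge0.
(* If [x j 0 = 1], then [Y (e_0 - e_j)] is a cone point of height 0, hence zero, and column [j] of
   [G] is [x]. This carries the coordinates equal to 1 over to the normalised columns. *)
have Gx1 i j : x j 0 = 1 -> G i j = x i 0.
  move=> xj; have [_ /Kcone_homogP[_ [y _]]] := GK j.
  rewrite xj subrr scale0r => /colP/(_ i); rewrite !mxE => /eqP.
  by rewrite subr_eq0 => /eqP.
have colb i : a i * \sum_j a j * G i j <= a i * (b * x i 0).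
  have [->|ai] := eqVneq (a i) 0; first by rewrite !mul0r.
  rewrite ler_wpM2l //; have [/Kcone_homogP[_ [y Py Gy]] _] := GK i.
  have GyE j : G i j = x i 0 * y j 0.
    by move/colP/(_ j): Gy; rewrite !mxE Gsym.
  have [xi|xi] := eqVneq (x i 0) 0.
    by rewrite big1 ?xi ?mulr0 // => j _; rewrite GyE xi mul0r mulr0.
  have xi_gt0 : 0 < x i 0 by rewrite lt_neqAle eq_sym xi x0.
  have -> : \sum_j a j * G i j = x i 0 * \sum_j a j * y j 0.
    by rewrite mulr_sumr; apply: eq_bigr => j _; rewrite GyE mulrCA.
  rewrite [b * _]mulrC ler_pM2l //; apply: (hval i) => //.
    by apply: (mulfI xi); rewrite -GyE Gd mulr1.
  by move=> j xj; apply: (mulfI xi); rewrite -GyE Gx1 // mulr1.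
have aGa : \sum_i \sum_j a i * a j * G i j <= b * t.
  rewrite /t mulr_sumr; apply: ler_sum => i _; rewrite mulrCA; apply: le_trans (colb i).
  by rewrite mulr_sumr le_eqVlt; apply/orP; left; apply/eqP/eq_bigr => j _; rewrite mulrA.
(* The scalar part [- t] minimises the form over its first argument and leaves
   [t ^+ 2 <= a^T G a]. *)
have := Gq (- t) a; rewrite /quad -/t => psd.
have tt : t * t <= b * t by nra.
have [t00|t00] := eqVneq t 0; first by rewrite t00.
by rewrite -(ler_pM2r (_ : 0 < t)) // lt_neqAle eq_sym t00.
Qed.

End LovaszSchrijver.

(** * Fractional packings: the upper bound *)

Section Packing.

Variables (R : realType) (n : nat) (V : finType) (E : 'I_n -> {set V}).
Variables (m : nat).
Hypotheses (m_gt0 : (0 < m)%N) (Em : forall s, #|E s| = m).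

Implicit Types (F M : {set 'I_n}) (x y : 'cV[R]_n) (s t : 'I_n).

Definition packing (x : 'cV[R]_n) : Prop :=
  (forall s, 0 <= x s 0 <= 1) /\ forall v, \sum_(s | v \in E s) x s 0 <= 1.

(** Packings are sets of indices rather than of edges because [E] need not be injective: several
    matchings cover the same vertex set. *)
Definition stable F : bool :=
  [forall s in F, forall t in F, (s != t) ==> [disjoint E s & E t]].

Lemma stableP F : reflect {in F &, forall s t, s != t -> [disjoint E s & E t]}
  (stable F).
Proof.
apply: (iffP forall_inP) => [h s t sF tF|h s sF].
  by move/forall_inP: (h s sF) => /(_ t tF)/implyP.
by apply/forall_inP => t tF; apply/implyP; apply: h.
Qed.

Lemma stableS (F F' : {set 'I_n}) : F' \subset F -> stable F -> stable F'.
Proof.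
move=> /subsetP FF /stableP h; apply/stableP => s t sF tF.
by apply: h; apply: FF.
Qed.

Definition chi (F : {set 'I_n}) : 'cV[R]_n := \col_s (s \in F)%:R.

Lemma edge_nonempty s : exists v, v \in E s.
Proof. by apply/set0Pn; rewrite -cards_eq0 Em -lt0n. Qed.

Lemma packing_convex : cone_convex packing.
Proof.
move=> z1 z2 [a [x [a0 [x01 xv] ->]]] [b [y [b0 [y01 yv] ->]]].
rewrite -homogD; have [ab0|ab0] := eqVneq (a + b) 0.
  have a00 : a = 0 by lra.
  have b00 : b = 0 by lra.
  by rewrite a00 b00 !scale0r !addr0 homog0; apply: (@Kcone0 _ _ _ x).
have ab_gt0 : 0 < a + b by rewrite lt_neqAle eq_sym ab0 addr_ge0.
apply/Kcone_homogP; split; first exact: ltW.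
exists ((a + b)^-1 *: (a *: x + b *: y)); last by rewrite scalerA divff // scale1r.
split=> [s|v].
  rewrite !mxE mulr_ge0 ?invr_ge0 ?addr_ge0 ?mulr_ge0 //=; try exact: ltW.
  - by rewrite ler_pdivrMl // mulr1; move: (x01 s) (y01 s); nra.
  - by case/andP: (x01 s).
  - by case/andP: (y01 s).
under eq_bigr => s _ do rewrite !mxE.
rewrite -mulr_sumr big_split /= -!mulr_sumr ler_pdivrMl // mulr1.
by move: (xv v) (yv v); nra.
Qed.

Lemma packing_chi F : stable F -> packing (chi F).
Proof.
move=> /stableP hF; split=> [s|v]; first by rewrite mxE; case: (s \in F); rewrite ?ler01 ?lexx.
have [[s vs sF]|none] := pselect (exists2 s, v \in E s & s \in F).
  rewrite (bigD1 s) //= mxE sF big1 ?addr0 // => t /andP[vt ts].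
  rewrite mxE; case: (boolP (t \in F)) => // tF.
  by have := disjointFr (hF _ _ tF sF ts) vt; rewrite vs.
rewrite big1 // => s vs; rewrite mxE; case: (boolP (s \in F)) => // sF.
by case: none; exists s.
Qed.

(** At a common vertex of [E s] and [E t], the index [t] already uses the whole capacity 1. *)
Lemma packing_conflict x s t : packing x -> x t 0 = 1 -> s != t ->
  ~~ [disjoint E s & E t] -> x s 0 = 0.
Proof.
move=> [x01 xv] xt st; rewrite -setI_eq0 => /set0Pn[v]; rewrite inE => /andP[vs vt].
have := xv v; rewrite (bigD1 t) //= xt (bigD1 s) /=; last by rewrite vs.
have : 0 <= \sum_(i | [&& v \in E i, i != t & i != s]) x i 0.
  by apply: sumr_ge0 => i _; case/andP: (x01 i).
under [X in 0 <= X -> _]eq_bigl => i do rewrite andbA.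
by case/andP: (x01 s); lra.
Qed.

Lemma packing_stable x (F : {set 'I_n}) : packing x ->
  (forall s, s \in F -> x s 0 = 1) -> stable F.
Proof.
move=> Px xF; apply/stableP => s t sF tF st.
apply: contraT => /(packing_conflict Px (xF t tF) st) /eqP.
by rewrite xF // oner_eq0.
Qed.

(** Double counting of incidences: each vertex lies in at most one edge of a packing. *)
Lemma stable_card F : stable F -> (#|F| * m <= #|V|)%N.
Proof.
move=> /stableP hF; have <- : (\sum_(s in F) #|E s| = #|F| * m)%N.
  by rewrite -sum_nat_const; apply: eq_bigr.
have -> : (\sum_(s in F) #|E s| = \sum_(v : V) #|[set s in F | v \in E s]|)%N.
  under eq_bigr => s _ do rewrite -sum1_card big_mkcond.
  rewrite exchange_big; apply: eq_bigr => v _ /=; rewrite -sum1_card.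
  rewrite big_mkcond [RHS]big_mkcond /=.
  by apply: eq_bigr => s _; rewrite inE; case: (s \in F).
rewrite -sum1_card; apply: leq_sum => v _; apply/card_le1_eqP => s t.
rewrite !inE => /andP[sF vs] /andP[tF vt]; apply/eqP; apply: contraT => st.
by rewrite (disjointFr (hF _ _ tF sF st) vt) in vs.
Qed.

Lemma packing_integral x : packing x -> (forall s, x s 0 = 0 \/ x s 0 = 1) ->
  exists2 F, stable F & x = chi F.
Proof.
move=> Px x01; exists [set s | x s 0 == 1].
  by apply: packing_stable Px _ => s; rewrite inE => /eqP.
apply/colP => s; rewrite mxE inE; case: (x01 s) => ->; last by rewrite eqxx.
by rewrite eq_sym oner_eq0.
Qed.

(** Farkas' lemma is applied to the homogenised packings, whose extra coordinate makes the
    multipliers sum to 1. Nonnegative [a] suffice because packings are closed under taking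
    subsets. *)
Lemma integer_hull_packing x : (forall s, 0 <= x s 0) ->
    (forall (a : 'I_n -> R) b, (forall s, 0 <= a s) ->
       (forall F, stable F -> \sum_(s in F) a s <= b) ->
       \sum_s a s * x s 0 <= b) ->
  integer_hull packing x.
Proof.
move=> x0 hx; pose L := enum [set F | stable F].
have dotE (y : 'rV[R]_(1 + n)) c z : (y *m homog c z) 0 0 =
    y 0 (lshift n 0) * c + \sum_s y 0 (rshift 1 s) * z s 0.
  rewrite mxE big_split_ord big_ord1 /= col_mxEu mxE eqxx mulr1n; congr (_ + _).
  by apply: eq_bigr => s _; rewrite col_mxEd.
have [y hy|c c0 hc] := @farkas R (1 + n) (size L)
    (fun j => homog 1 (chi (nth set0 L j))) (homog 1 x).
  have hyF F : stable F ->
      0 <= y 0 (lshift n 0) + \sum_(s in F) y 0 (rshift 1 s).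
    move=> sF; have FL : F \in L by rewrite mem_enum inE.
    have := hy (index F L); rewrite index_mem FL => /(_ isT).
    rewrite dotE nth_index // mulr1 [in X in _ -> X]big_mkcond.
    rewrite (eq_bigr (fun s => if s \in F then y 0 (rshift 1 s) else 0)) //.
    by move=> s _; rewrite mxE; case: (s \in F); rewrite ?mulr1 ?mulr0.
  rewrite dotE mulr1.
  pose a s := Num.max (- y 0 (rshift 1 s)) 0.
  have : \sum_s a s * x s 0 <= y 0 (lshift n 0).
    apply: hx => [s|F sF]; first by rewrite /a le_max lexx orbT.
    (* Only the indices of [F] with negative [y] contribute to the sum of [a], and they form a
       packing themselves. *)
    have := hyF [set s in F | y 0 (rshift 1 s) < 0] _.
    rewrite -lerBlDr sub0r -sumrN => le_y0; apply: le_trans (le_y0 _); last first.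
      by apply: stableS sF; apply/subsetP => s; rewrite inE => /andP[].
    rewrite big_mkcond [X in _ <= X]big_mkcond; apply: ler_sum => s _.
    rewrite inE; case: (s \in F) => //=; rewrite /a; case: ltP => ys.
      by rewrite max_l // oppr_ge0 ltW.
    by rewrite max_r // oppr_le0.
  rewrite -subr_ge0 -sumrN; move/le_trans; apply.
  rewrite lerD2l; apply: ler_sum => s _; rewrite -mulNr ler_wpM2r //.
  by rewrite lerNl le_max lexx.
have hom_sum : homog 1 x = homog (\sum_(j < size L) c j)
    (\sum_(j < size L) c j *: chi (nth set0 L j)).
  rewrite hc; elim: (index_enum _) => [|j s IH]; first by rewrite !big_nil homog0.
  by rewrite !big_cons homogD IH -homogZ mulr1.
have [c1 xE] := homog_inj hom_sum.
exists (size L), (fun j => c j), (fun j => chi (nth set0 L j)); split=> // j.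
split; last by move=> s; rewrite mxE; case: (_ \in _); [right | left].
apply: packing_chi; have := mem_nth set0 (ltn_ord j).
by rewrite mem_enum inE.
Qed.

(** The sum [j + #|M|] is invariant along the induction, so the room left always matches the rounds
    left. At [j = 0] no further edge fits and [x] is [chi M]. *)
Lemma iter_LSp_packing_valid (s0 : 'I_n) j x (M : {set 'I_n}) (a : 'I_n -> R) b :
    iter j (@LSp R n) packing x -> (forall s, s \in M -> x s 0 = 1) ->
    (#|V| < (j.+1 + #|M|) * m)%N -> (forall s, 0 <= a s) ->
    (forall F, stable F -> M \subset F -> \sum_(s in F) a s <= b) ->
  \sum_s a s * x s 0 <= b.
Proof.
elim: j x M => [|j IH] x M LSx xM cM a0 hF.
  have sM := packing_stable LSx xM.
  have x0 s : s \notin M -> x s 0 = 0.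
    move=> sM'; apply/eqP; apply: contraT => xs0.
    suff /stable_card : stable (s |: M) by rewrite cardsU1 sM' leqNgt cM.
    have dis t : t \in M -> [disjoint E s & E t].
      move=> tM; apply: contraT => nd; move: xs0.
      rewrite (packing_conflict LSx (xM t tM) _ nd) ?eqxx //.
      by apply: contraNneq sM' => ->.
    apply/stableP => t t'; rewrite !inE => /predU1P[->|tM] /predU1P[->|tM'].
    - by rewrite eqxx.
    - by move=> _; apply: dis.
    - by move=> _; rewrite disjoint_sym; apply: dis.
    - by move: t t' tM tM'; apply/stableP.
  apply: le_trans (hF M sM (subxx _)); rewrite [X in _ <= X]big_mkcond.
  apply: ler_sum => s _; case: ifPn => sM'; first by rewrite xM // mulr1.
  by rewrite x0 // mulr0.
have Px : packing x by apply: (@iter_LSp_sub _ _ _ _ s0 j.+1) => //; apply: packing_convex.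
have sM := packing_stable Px xM.
(* Erasing the weights on [M] ensures that every index met in [LSp_valid] lies outside [M] and
   enlarges it. *)
pose a' s := if s \in M then 0 else a s.
have splitM y : (forall s, s \in M -> y s 0 = 1) ->
    \sum_s a s * y s 0 = \sum_s a' s * y s 0 + \sum_(s in M) a s.
  move=> yM; rewrite [X in _ + X]big_mkcond -big_split; apply: eq_bigr => s _ /=.
  rewrite /a'; case: (boolP (s \in M)) => sM'; last by rewrite addr0.
  by rewrite yM // mul0r add0r mulr1.
rewrite splitM // -lerBrDr; apply: (LSp_valid LSx) => //.
- by move=> s; case: Px => x01 _; case/andP: (x01 s).
- by move=> s; rewrite /a'; case: ifP.
- by rewrite subr_ge0 hF.
move=> s y a's xs LSy ys yM.
have sM' : s \notin M by apply: contraNN a's => sM'; rewrite /a' sM'.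
have yM' t : t \in M -> y t 0 = 1 by move=> tM; apply/yM/xM.
rewrite lerBrDr -splitM //; apply: (IH y (s |: M)) => //.
- by move=> t /setU1P[->//|]; apply: yM'.
- by rewrite cardsU1 sM' addnA addn1.
- move=> F sF /subsetP MF; apply: hF sF _; apply/subsetP => t tM.
  by rewrite MF // !inE tM orbT.
Qed.

Lemma iter_LSp_packing_sub (s0 : 'I_n) x :
  iter (#|V| %/ m) (@LSp R n) packing x -> integer_hull packing x.
Proof.
move=> LSx; apply: integer_hull_packing => [s|a b a0 hF].
  have [x01 _] := iter_LSp_sub s0 packing_convex LSx.
  by case/andP: (x01 s).
apply: (iter_LSp_packing_valid s0 (M := set0) LSx) => //.
- by move=> s; rewrite inE.
- by rewrite cards0 addn0 ltn_ceil.
- by move=> F sF _; apply: hF.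
Qed.

Lemma integer_hull_packing_sum x : integer_hull packing x ->
  \sum_s x s 0 <= (#|V| %/ m)%N%:R.
Proof.
move=> [d [c [y [c0 c1 Py ->]]]].
rewrite (eq_bigr (fun s => \sum_j c j * y j s 0)); last first.
  by move=> s _; rewrite summxE; apply: eq_bigr => j _; rewrite mxE.
rewrite exchange_big /= -[leRHS]mul1r -[X in _ <= X * _]c1 mulr_suml; apply: ler_sum => j _.
rewrite -mulr_sumr ler_wpM2l //; have [Pyj y01] := Py j.
have [F sF ->] := packing_integral Pyj y01.
have -> : \sum_s chi F s 0 = #|F|%:R.
  rewrite -sum1_card natr_sum [RHS]big_mkcond.
  by apply: eq_bigr => s _; rewrite mxE; case: (s \in F).
by rewrite ler_nat leq_divRL // stable_card.
Qed.

End Packing.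

(** * Fractional packings: the lower bound *)

Section LowerBound.

Variables (R : realType) (n : nat) (V : finType) (E : 'I_n -> {set V}).
Variables (m N : nat).
Hypotheses (m_gt0 : (0 < m)%N) (N_gt0 : (0 < N)%N) (Em : forall s, #|E s| = m).
Hypothesis EN : forall T : {set V}, #|T| = m -> #|[set s | E s == T]| = N.

Implicit Types (F M : {set 'I_n}) (x y : 'cV[R]_n) (s t : 'I_n).

Lemma card_edges (A : pred {set V}) :
  #|[set s | A (E s)]| = (N * #|[set T : {set V} | A T & #|T| == m]|)%N.
Proof.
rewrite -sum1_card (partition_big E [pred T | A T & #|T| == m]) /=; last first.
  by move=> s; rewrite inE Em eqxx andbT.
rewrite mulnC -sum_nat_const; apply: eq_big => [T|T]; first by rewrite inE.
move=> /andP[AT /eqP Tm]; rewrite -(EN Tm) -[RHS]sum1_card.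
by apply: eq_bigl => s; rewrite !inE; case: eqP => [->|]; rewrite ?AT ?andbF.
Qed.

(* The number of indices s with v \in E s \subset W, for v \in W and
   w = #|W|. *)
Definition edge_degree (w : nat) : R := (N * 'C(w.-1, m.-1))%:R.

Lemma edge_degree_gt0 w : (m <= w)%N -> 0 < edge_degree w.
Proof. by move=> mw; rewrite ltr0n muln_gt0 N_gt0 bin_gt0; lia. Qed.

(** The normalisation makes the sum at each vertex of [W] equal to 1 as soon as [m <= #|W|]. *)
Definition uniform (W : {set V}) s : R := (E s \subset W)%:R / edge_degree #|W|.

Lemma uniform_ge0 W s : 0 <= uniform W s.
Proof. by rewrite divr_ge0. Qed.

Lemma sum_uniform (W : {set V}) v : (m <= #|W|)%N ->
  \sum_(s | v \in E s) uniform W s = (v \in W)%:R.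
Proof.
move=> mW; rewrite /uniform -mulr_suml; case: (boolP (v \in W)) => vW; last first.
  rewrite big1 ?mul0r // => s vs; case: (boolP (E s \subset W)) => // /subsetP sW.
  by rewrite sW in vW.
suff -> : \sum_(s | v \in E s) (E s \subset W)%:R = edge_degree #|W|.
  by rewrite divff // gt_eqF // edge_degree_gt0.
rewrite /edge_degree -(card_draws_mem vW m_gt0).
have -> : [set S : {set V} | [&& S \subset W, #|S| == m & v \in S]] =
    [set S : {set V} | (S \subset W) && (v \in S) & #|S| == m].
  by apply/setP => S; rewrite !inE andbA andbAC.
rewrite -(card_edges [pred S : {set V} | (S \subset W) && (v \in S)]).
rewrite -sum1_card natr_sum big_mkcond [RHS]big_mkcond; apply: eq_bigr => s _.
by rewrite inE /=; case: (_ \subset _); case: (_ \in _).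
Qed.

Definition rest M : {set V} := [set v | [forall s in M, v \notin E s]].

Lemma restP M v : reflect (forall s, s \in M -> v \notin E s) (v \in rest M).
Proof. by rewrite inE; apply: forall_inP. Qed.

Lemma rest0 : rest set0 = setT.
Proof. by apply/setP => v; rewrite [RHS]inE; apply/restP => s; rewrite inE. Qed.

Lemma rest_notin M s : s \in M -> E s \subset rest M = false.
Proof.
move=> sM; apply/negP => /subsetP sW; have [v vs] := edge_nonempty m_gt0 Em s.
by move/restP: (sW v vs) => /(_ s sM); rewrite vs.
Qed.

Lemma restU1 M s : rest (s |: M) = rest M :\: E s.
Proof.
apply/setP => v; rewrite in_setD; apply/restP/andP => [h|[vs /restP h] t].
  by rewrite h ?setU11 //; split=> //; apply/restP => t tM; rewrite h // setU1r.
by case/setU1P => [->|/h].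
Qed.

Lemma stableU1 M s : stable E M -> E s \subset rest M -> stable E (s |: M).
Proof.
move=> /stableP sM /subsetP sW.
have dis t : t \in M -> [disjoint E s & E t].
  move=> tM; apply/pred0P => v /=; apply/negP => /andP[/sW/restP h vt].
  by rewrite (negPf (h t tM)) in vt.
apply/stableP => t t' /setU1P[->|tM] /setU1P[->|tM'].
- by rewrite eqxx.
- by move=> _; apply: dis.
- by move=> _; rewrite disjoint_sym; apply: dis.
- exact: sM.
Qed.

Definition extension M : 'cV[R]_n := \col_s ((s \in M)%:R + uniform (rest M) s).

Lemma sum_extension M v : stable E M -> (m <= #|rest M|)%N ->
  \sum_(s | v \in E s) extension M s 0 = 1.
Proof.
move=> /stableP sM mM; under eq_bigr => s _ do rewrite mxE.
rewrite big_split sum_uniform //=; case: (boolP (v \in rest M)) => [/restP h|].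
  rewrite big1 ?add0r // => s vs; case: (boolP (s \in M)) => // sM'.
  by rewrite (negPf (h s sM')) in vs.
rewrite inE negb_forall_in => /exists_inP[s sM']; rewrite negbK => vs.
rewrite addr0 (bigD1 s) //= sM' big1 ?addr0 // => t /andP[vt ts].
case: (boolP (t \in M)) => // tM.
by have := disjointFr (sM _ _ tM sM' ts) vt; rewrite vs.
Qed.

Lemma extension_ge0 M s : 0 <= extension M s 0.
Proof. by rewrite mxE addr_ge0 // uniform_ge0. Qed.

Lemma packing_extension M : stable E M -> (m <= #|rest M|)%N ->
  packing E (extension M).
Proof.
move=> sM mM; split=> [s|v]; last by rewrite sum_extension.
rewrite extension_ge0; have [v vs] := edge_nonempty m_gt0 Em s.
rewrite -(sum_extension v sM mM) (bigD1 s) //= lerDl.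
by apply: sumr_ge0 => t _; apply: extension_ge0.
Qed.

(** Read formally as a pair probability: [s] is chosen with mass [uniform W s], and given [s] the
    other edges are uniform on [W :\: E s]. *)
Definition edge_kernel (W : {set V}) s t : R :=
  uniform W s * ((s == t)%:R + uniform (W :\: E s) t).

(** In this form the symmetry is visible, and on the edges inside [W] the kernel is a multiple of
    the identity plus a multiple of the disjointness relation. *)
Lemma edge_kernelE (W : {set V}) s t : edge_kernel W s t =
  (E s \subset W)%:R * (E t \subset W)%:R / edge_degree #|W| *
  ((s == t)%:R + [disjoint E s & E t]%:R / edge_degree (#|W| - m)).
Proof.
rewrite /edge_kernel /uniform; case: (boolP (E s \subset W)) => sW; last by rewrite !mul0r.
rewrite subsetD cardsDS // Em mul1r disjoint_sym.
case: (boolP (E t \subset W)) => tW; first by rewrite /= !mul1r.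
have -> : (s == t) = false by apply: contraNF tW => /eqP <-.
by rewrite /= ?(mul0r, addr0, mulr0).
Qed.

Lemma edge_kernelC (W : {set V}) s t : edge_kernel W s t = edge_kernel W t s.
Proof.
by rewrite !edge_kernelE eq_sym disjoint_sym [_%:R * _%:R]mulrC.
Qed.

(** Summing [g] over the fibres of [E] gives a function [h] on [m]-sets. The disjointness part
    becomes the Kneser form of [h] exactly, and the diagonal part dominates [kdot h h / N] by
    Cauchy-Schwarz on each fibre, so [kneser_psd] applies. *)
Lemma edge_kernel_psd (W : {set V}) (g : 'I_n -> R) : (m.*2 <= #|W|)%N ->
  0 <= \sum_s \sum_t g s * g t * edge_kernel W s t.
Proof.
move=> mW; pose h T := \sum_(s | E s == T) g s.
pose C : R := 'C((#|W| - m).-1, m.-1)%:R.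
have NC : edge_degree (#|W| - m) = N%:R * C by rewrite /edge_degree natrM.
have C_gt0 : 0 < C by rewrite ltr0n bin_gt0; lia.
have N_gt0' : 0 < N%:R :> R by rewrite ltr0n.
have dW : 0 < edge_degree #|W| by apply: edge_degree_gt0; lia.
have byT (f : 'I_n -> R) (A : pred {set V}) : \sum_(s | A (E s)) f s =
    \sum_(T | A T && (#|T| == m)) \sum_(s | E s == T) f s.
  rewrite (partition_big E [pred T | A T & #|T| == m]) /=; last first.
    by move=> s; rewrite Em eqxx andbT.
  apply: eq_bigr => T /andP[AT _]; apply: eq_bigl => s.
  by case: eqP => [->|]; rewrite ?AT ?andbF.
pose Q1 := \sum_(s | E s \subset W) g s ^+ 2.
pose Q2 := \sum_(s | E s \subset W)
  \sum_(t | (E t \subset W) && [disjoint E t & E s]) g s * g t.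
have -> : \sum_s \sum_t g s * g t * edge_kernel W s t =
    (edge_degree #|W|)^-1 * (Q1 + Q2 / (N%:R * C)).
  rewrite /Q1 /Q2 mulr_suml -big_split mulr_sumr [RHS]big_mkcond /=.
  apply: eq_bigr => s _; case: ifPn => sW; last first.
    by rewrite big1 // => t _; rewrite edge_kernelE (negPf sW) !mul0r mulr0.
  transitivity (\sum_t (g s * g t * ((s == t)%:R / edge_degree #|W|) +
     (edge_degree #|W|)^-1 * ((if (E t \subset W) && [disjoint E t & E s]
      then g s * g t else 0) / (N%:R * C)))).
    apply: eq_bigr => t _; rewrite edge_kernelE sW NC disjoint_sym.
    have [<-|_] := eqVneq s t.
      by rewrite sW; case: [disjoint _ & _] => /=; ring.
    by case: (_ \subset _); case: [disjoint _ & _] => /=; ring.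
  rewrite big_split -mulr_sumr -mulr_suml -big_mkcond /=.
  rewrite (bigD1 s) //= big1 => [|t ts]; last first.
    by rewrite eq_sym (negPf ts) mul0r mulr0.
  by rewrite eqxx addr0 mul1r mulrDr [X in X + _]mulrC expr2.
apply: mulr_ge0; first by rewrite invr_ge0 ltW.
have sl T : slice m W T = (T \subset W) && (#|T| == m) by [].
have Q1h : kdot m W h h <= N%:R * Q1.
  rewrite /Q1 (byT _ [pred T : {set V} | T \subset W]) /kdot mulr_sumr.
  apply: ler_sum => T /andP[_ /eqP Tm].
  have NT : \sum_(s | E s == T) 1 ^+ 2 = N%:R :> R.
    rewrite -(EN Tm) -sum1_card natr_sum.
    by apply: eq_big => s; rewrite ?inE ?expr1n.
  have := cauchy_schwarz (fun s => E s == T) (fun=> 1) g.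
  by under eq_bigr => s _ do rewrite mul1r; rewrite NT -/(h T) expr2.
have Q2h : kdot m W h (kneser m W h) = Q2.
  rewrite /Q2 (byT _ [pred T : {set V} | T \subset W]) /kdot.
  apply: eq_bigr => T _; rewrite mulr_suml; apply: eq_bigr => s /eqP sT.
  rewrite -mulr_sumr sT; congr (_ * _).
  rewrite (byT _ [pred S : {set V} | (S \subset W) && [disjoint S & T]]).
  by apply: eq_bigl => S; rewrite sl /= andbAC.
have := kneser_psd m_gt0 mW h; rewrite -/C Q2h => psd.
rewrite -(pmulr_rge0 _ (mulr_gt0 N_gt0' C_gt0)) mulrDr mulrCA divff ?mulr1; last first.
  by rewrite mulf_neq0 // gt_eqF.
apply: le_trans psd _; rewrite lerD2r.
suff -> : N%:R * C * Q1 = C * (N%:R * Q1) by rewrite ler_pM2l.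
ring.
Qed.

(* Second moments of the union of M with a random matching of rest M whose first
   and second moments would be [uniform] and [edge_kernel]. *)
Definition extension_matrix M : 'M[R]_n :=
  \matrix_(s, t) (extension M s 0 * extension M t 0 -
    uniform (rest M) s * uniform (rest M) t + edge_kernel (rest M) s t).

Lemma extension_matrixC M s t : extension_matrix M s t = extension_matrix M t s.
Proof. by rewrite !mxE edge_kernelC; ring. Qed.

(** Conditioning on [s] adds it to [M] if its edge is free. Otherwise either [s] is in [M], with
    coordinate 1, or its coordinate is 0, and [M] stays. *)
Lemma col_extension_matrix M s :
  col s (extension_matrix M) = extension M s 0 *:
    extension (if E s \subset rest M then s |: M else M).
Proof.
apply/colP => t; rewrite [LHS]mxE [LHS]mxE edge_kernelC /edge_kernel [RHS]mxE.
case: (boolP (E s \subset rest M)) => sW; last first.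
  have -> : uniform (rest M) s = 0 by rewrite /uniform (negPf sW) mul0r.
  by rewrite mul0r mulr0 subr0 addr0 mulrC.
have sM : (s \in M) = false by apply: contraTF sW => /rest_notin ->.
rewrite -restU1 ![extension _ _ _]mxE sM add0r !inE eq_sym.
have [->|_] := eqVneq t s; last by rewrite /=; ring.
by rewrite sM /=; ring.
Qed.

(* With h the indicator of the edges at a vertex v of W, K h = u and
   h^T K h = 1; hence K - u u^T is positive semidefinite. *)
Lemma extension_quad M a f : stable E M -> (m.*2 <= #|rest M|)%N ->
  0 <= quad (extension M) (extension_matrix M) a f.
Proof.
move=> sM mM; have mM' : (m <= #|rest M|)%N by lia.
have [v vM] : exists v, v \in rest M by apply/set0Pn; rewrite -card_gt0; lia.
set W := rest M in mM mM' vM *; set u := uniform W; set K := edge_kernel W.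
pose x s := extension M s 0.
have KW s : \sum_t (v \in E t)%:R * K s t = u s.
  have hsum (F : 'I_n -> R) : \sum_t (v \in E t)%:R * F t = \sum_(t | v \in E t) F t.
    by rewrite [RHS]big_mkcond; apply: eq_bigr => t _; case: ifP; rewrite ?mul1r ?mul0r.
  rewrite hsum /K /edge_kernel -mulr_sumr -/u; case: (boolP (E s \subset W)) => sW; last first.
    by rewrite /u /uniform (negPf sW) !mul0r.
  rewrite big_split /= sum_uniform; last by rewrite cardsDS // Em; lia.
  have -> : \sum_(t | v \in E t) (s == t)%:R = (v \in E s)%:R :> R.
    rewrite big_mkcond (bigD1 s) //= eqxx big1 ?addr0; first by case: (v \in _).
    by move=> t ts; rewrite eq_sym (negPf ts); case: ifP.
  (* Exactly one of the two terms is 1, since [v] lies either in [E s] or in [W :\: E s]. *)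
  by rewrite in_setD vM andbT; case: (v \in _); rewrite ?addr0 ?add0r mulr1.
have hu : \sum_s (v \in E s)%:R * u s = 1.
  have vM1 : (v \in W)%:R = 1 :> R by rewrite vM.
  rewrite -[RHS]vM1 -(sum_uniform v mM') [RHS]big_mkcond.
  by apply: eq_bigr => t _; case: ifP; rewrite ?mul1r ?mul0r.
pose b := \sum_s f s * u s.
(* Subtracting [b] times the indicator of the edges at [v] turns the form of [K] at [f] into that of
   [K - u u^T]. *)
have := edge_kernel_psd (fun s => f s - b * (v \in E s)%:R) mM.
have -> : \sum_s \sum_t (f s - b * (v \in E s)%:R) * (f t - b * (v \in E t)%:R) *
    edge_kernel W s t = \sum_s \sum_t f s * f t * K s t - b ^+ 2.
  have Kfh : \sum_s \sum_t f s * (v \in E t)%:R * K s t = b.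
    by apply: eq_bigr => s _; rewrite -KW mulr_sumr; apply: eq_bigr => t _; rewrite mulrA.
  have Khf : \sum_s \sum_t (v \in E s)%:R * f t * K s t = b.
    rewrite -[RHS]Kfh [RHS]exchange_big; apply: eq_bigr => s _; apply: eq_bigr => t _ /=.
    by rewrite /K edge_kernelC; ring.
  have Khh : \sum_s \sum_t (v \in E s)%:R * (v \in E t)%:R * K s t = 1.
    rewrite -[RHS]hu; apply: eq_bigr => s _; rewrite -KW mulr_sumr.
    by apply: eq_bigr => t _; rewrite mulrA.
  transitivity (\sum_s \sum_t f s * f t * K s t
     - b * \sum_s \sum_t f s * (v \in E t)%:R * K s t
     - b * \sum_s \sum_t (v \in E s)%:R * f t * K s t
     + b ^+ 2 * \sum_s \sum_t (v \in E s)%:R * (v \in E t)%:R * K s t).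
    rewrite !mulr_sumr -!sumrB -big_split; apply: eq_bigr => s _ /=.
    rewrite !mulr_sumr -!sumrB -big_split; apply: eq_bigr => t _ /=.
    by rewrite -/K; ring.
  by rewrite Kfh Khf Khh; ring.
suff -> : quad (extension M) (extension_matrix M) a f =
    (a + \sum_s f s * x s) ^+ 2 + (\sum_s \sum_t f s * f t * K s t - b ^+ 2).
  by move=> psd; rewrite addr_ge0 // sqr_ge0.
rewrite /quad.
have -> : \sum_s \sum_t f s * f t * extension_matrix M s t =
    (\sum_s f s * x s) ^+ 2 - b ^+ 2 + \sum_s \sum_t f s * f t * K s t.
  rewrite !expr2 /b !mulr_suml -sumrB -big_split; apply: eq_bigr => s _ /=.
  rewrite !mulr_sumr -sumrB -big_split; apply: eq_bigr => t _ /=.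
  by rewrite mxE -/W -/u -/K -/(x s) -/(x t); ring.
by rewrite -/(x _); ring.
Qed.

Lemma iter_LSp_extension j M : stable E M -> (j.+1 * m <= #|rest M|)%N ->
  iter j (@LSp R n) (packing E) (extension M).
Proof.
elim: j M => [|j IH] M sM mM; first by apply: packing_extension => //; lia.
have mM' : (m.*2 <= #|rest M|)%N by move: mM; rewrite !mulSn; lia.
apply/LSpP; exists (extension_matrix M).
pose ext s := extension (if E s \subset rest M then s |: M else M).
have extP s : [/\ iter j (@LSp R n) (packing E) (ext s) &
    forall v, \sum_(t | v \in E t) ext s t 0 = 1].
  rewrite /ext; case: ifP => sW; last first.
    split=> [|v]; first by apply: IH => //; move: mM; rewrite !mulSn; lia.
    by apply: sum_extension => //; lia.
  have cW : #|rest (s |: M)| = (#|rest M| - m)%N by rewrite restU1 cardsDS // Em.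
  split=> [|v]; first by apply: IH; rewrite ?stableU1 // cW; move: mM; rewrite !mulSn; lia.
  by apply: sum_extension; rewrite ?stableU1 // cW; lia.
have colK s : Kcone (iter j (@LSp R n) (packing E))
    (homog (extension M s 0) (col s (extension_matrix M))).
  rewrite col_extension_matrix; apply/Kcone_homogP; split; first exact: extension_ge0.
  by exists (ext s) => //; case: (extP s).
split.
- exact: extension_matrixC.
- move=> s; have := congr1 (fun y : 'cV[R]_n => y s 0) (col_extension_matrix M s).
  rewrite [LHS]mxE [X in _ = X -> _]mxE => ->.
  have [->|xs] := eqVneq (extension M s 0) 0; first by rewrite mul0r.
  rewrite -[RHS]mulr1; congr (_ * _); rewrite mxE.
  case: (boolP (E s \subset rest M)) => sW.
    rewrite setU11 restU1 /uniform subsetD sW /=.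
    case: (boolP [disjoint _ & _]) => [|_]; last by rewrite mul0r addr0.
    by rewrite -setI_eq0 setIid -cards_eq0 Em; case: (m) m_gt0.
  case: (boolP (s \in M)) => sM'; first by rewrite /uniform (negPf sW) mul0r addr0.
  by move: xs; rewrite mxE (negPf sM') /uniform (negPf sW) mul0r addr0 eqxx.
- move=> s; split; first exact: colK.
  have [v vs] := edge_nonempty m_gt0 Em s.
  (* For [v] in [E s], the columns of the edges at [v] sum to [Y e_0]; removing column [s] leaves a
     sum of cone points. *)
  have -> : homog (1 - extension M s 0) (extension M - col s (extension_matrix M)) =
      \sum_(t | (v \in E t) && (t != s))
        homog (extension M t 0) (col t (extension_matrix M)).
    have -> : homog (1 - extension M s 0) (extension M - col s (extension_matrix M)) =
        homog 1 (extension M) - homog (extension M s 0) (col s (extension_matrix M)).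
      by apply/(canRL (addrK _)); rewrite -homogD !subrK.
    apply/(canLR (addrK _)); rewrite addrC -bigD1 //.
    transitivity (homog (\sum_(t | v \in E t) extension M t 0)
        (\sum_(t | v \in E t) col t (extension_matrix M))).
      rewrite sum_extension //; last by lia.
      congr homog; apply/colP => t; rewrite summxE.
      under eq_bigr => w _ do rewrite mxE extension_matrixC.
      (* By symmetry, entry [t] of the sum of columns is read off column [t], a multiple of [ext t],
         whose sum at [v] is 1. *)
      transitivity (\sum_(w | v \in E w) extension M t 0 * ext t w 0).
        by rewrite -mulr_sumr; case: (extP t) => _ ->; rewrite mulr1.
      apply: eq_bigr => w _.
      have := congr1 (fun y : 'cV[R]_n => y w 0) (col_extension_matrix M t).
      by rewrite [LHS]mxE [X in _ = X -> _]mxE extension_matrixC => ->.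
    elim: (index_enum _) => [|w l IHl]; first by rewrite !big_nil homog0.
    by rewrite !big_cons; case: ifP => // _; rewrite homogD IHl.
  have [LSe _] := extP s; apply: (Kcone_sum _ LSe) => //.
  by apply: iter_LSp_convex; apply: packing_convex.
- by move=> a f; apply: extension_quad.
Qed.

(** Adding the vertex sums, all equal to 1, counts each coordinate [m] times. So the coordinate sum
    is [#|V| / m], above the integral bound when [m] does not divide [#|V|]. *)
Lemma extension_not_integral : (m <= #|V|)%N -> ~~ (m %| #|V|)%N ->
  ~ integer_hull (packing E) (extension set0).
Proof.
move=> mV ndvd /(integer_hull_packing_sum m_gt0 Em).
have s0 : stable E set0 by apply/stableP => s; rewrite inE.
suff sumE : \sum_s extension set0 s 0 * m%:R = #|V|%:R.
  rewrite -(ler_pM2r (_ : 0 < m%:R)) ?ltr0n // mulr_suml sumE -natrM ler_nat.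
  by rewrite leqNgt ltn_neqAle leq_trunc_div andbT -dvdn_eq ndvd.
transitivity (\sum_s \sum_(v in E s) extension set0 s 0).
  by apply: eq_bigr => s _; rewrite sumr_const Em mulr_natr.
rewrite (exchange_big_dep predT) //= -sum1_card natr_sum; apply: eq_bigr => v _.
by rewrite sum_extension // rest0 cardsT.
Qed.

Lemma packing_LSp_rank : (m <= #|V|)%N -> ~~ (m %| #|V|)%N ->
  is_LSp_rank (packing E : classical_sets.set 'cV[R]_n) (#|V| %/ m).
Proof.
move=> mV ndvd; split=> [|j jP]; last first.
  rewrite leqNgt; apply/negP => jk; apply: (extension_not_integral mV ndvd).
  rewrite -jP; apply: iter_LSp_extension; first by apply/stableP => s; rewrite inE.
  by rewrite rest0 cardsT -leq_divRL.
have [|T _ /EN Tm] := @exists_draw V [set: V] m; first by rewrite cardsT.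
have /card_gt0P[s0 _] : (0 < #|[set s | E s == T]|)%N by rewrite Tm.
apply: funext => x; apply: propext; split.
  exact: (iter_LSp_packing_sub m_gt0 Em s0).
by apply: integer_hull_sub_LSp; apply: packing_convex.
Qed.

End LowerBound.

(** * Matchings of the complete uniform hypergraph *)

Section Matchings.

Variables (V : finType) (q : nat).
Hypothesis q_gt0 : (0 < q)%N.

Let G : {set {set V}} := [set e : {set V} | #|e| == q].

Lemma card_cover_matching r S : S \in matchings G r -> #|cover S| = (q * r)%N.
Proof.
rewrite inE => /and3P[/subsetP SG /eqP <- /eqP <-].
rewrite mulnC -sum_nat_const; by apply: eq_bigr => e /SG; rewrite inE => /eqP.
Qed.

Lemma exists_matching r (T : {set V}) : #|T| = (q * r)%N ->
  exists2 S, S \in matchings G r & cover S = T.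
Proof.
elim: r T => [|r IH] T Tr.
  have c0 : cover (set0 : {set {set V}}) = set0 by rewrite /cover big_set0.
  exists set0; last by rewrite c0; apply/esym/eqP; rewrite -cards_eq0 Tr muln0.
  by rewrite inE sub0set cards0 eqxx /= /trivIset big_set0 c0 cards0.
have [|e eT eq] := @exists_draw _ T q; first by rewrite Tr mulnS leq_addr.
have [|S] := IH (T :\: e); first by rewrite cardsDS // Tr eq mulnS addKn.
rewrite inE => /and3P[SG /eqP Sr triS] cS.
have dis f : f \in S -> [disjoint e & f].
  move=> fS; rewrite disjoint_sym; have : f \subset cover S by apply: bigcup_sup.
  by rewrite cS subsetD => /andP[].
(* [trivIsetU1] needs this to conclude that [e] is not already in [S]. *)
have S0 : set0 \notin S.
  apply/negP => /(subsetP SG); rewrite inE cards0 => /eqP q0.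
  by move: q_gt0; rewrite -q0.
have [triU eS] := trivIsetU1 dis triS S0.
exists (e |: S); last first.
  rewrite /cover bigcup_setU big_set1 -/(cover S) cS.
  apply/setP => v; rewrite !inE; case: (boolP (v \in e)) => //.
  by move/(subsetP eT) ->.
by rewrite inE subUset sub1set inE eq eqxx SG cardsU1 eS Sr add1n eqxx triU.
Qed.

Definition matching_count r (T : {set V}) : nat :=
  #|[set S in matchings G r | cover S == T]|.

(** Applying [s] to the hyperedges is injective on matchings. An inequality suffices, as it is also
    used for the transposition that swaps back. *)
Lemma matching_count_perm r (s : {perm V}) (T : {set V}) :
  (matching_count r T <= matching_count r (s @: T))%N.
Proof.
have sI : injective (fun e : {set V} => s @: e) by apply/imset_inj/perm_inj.
have sSI := imset_inj sI.
rewrite /matching_count -(card_imset _ sSI); apply/subset_leq_card/subsetP => S'.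
case/imsetP => S; rewrite !inE => /andP[/and3P[/subsetP SG Sr triS] /eqP <-] ->.
have coverS : cover ((fun e : {set V} => s @: e) @: S) = s @: cover S.
  by rewrite cover_imset -imset_cover.
rewrite coverS eqxx andbT; apply/and3P; split.
- apply/subsetP => e' /imsetP[e /SG]; rewrite !inE => /eqP <- ->.
  by rewrite card_imset //; apply: perm_inj.
- by rewrite card_imset.
rewrite /trivIset coverS card_imset; last exact: perm_inj.
rewrite big_imset /=; last by move=> e e' _ _; apply: sI.
by rewrite -(eqP triS); apply/eqP/eq_bigr => e _; rewrite card_imset //; apply: perm_inj.
Qed.

(* Transpositions preserve the count, so it is swap-Lipschitz with constant 0. *)
Lemma matching_count_const r (T T' : {set V}) : #|T| = #|T'| ->
  matching_count r T = matching_count r T'.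
Proof.
move=> TT'; apply/eqP; rewrite -(eqr_nat rat) -subr_eq0 -normr_le0.
rewrite -[leRHS](mulr0 (#|T :\: T'|%:R : rat)).
have swap0 : swap_lipschitz #|T| setT 0 (fun T => (matching_count r T)%:R : rat).
  move=> U a b _ aU _ bU; rewrite normr_le0 subr_eq0 eqr_nat.
  have swapE (X : {set V}) c d : c \in X -> d \notin X -> swap X c d = tperm c d @: X.
    move=> cX dX; apply/setP => v; rewrite -{2}[v](tpermK c d) mem_imset; last exact: perm_inj.
    rewrite !inE; case: tpermP => [->|->|/eqP vc /eqP vd].
    - by rewrite eqxx (negPf dX) /= orbF; apply: contraTF cX => /eqP ->.
    - by rewrite eqxx cX.
    - by rewrite vc (negPf vd).
  have ab : a != b by apply: contraNneq bU => <-.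
  rewrite eqn_leq; apply/andP; split; first by rewrite swapE // matching_count_perm.
  rewrite -{2}(swapK aU bU) (swapE _ b a) ?matching_count_perm //; first by rewrite !inE eqxx.
  by rewrite !inE (negPf ab) eqxx.
by apply: (swap_lipschitz_dist swap0); rewrite /slice /= subsetT ?TT' eqxx.
Qed.

End Matchings.

Theorem theorem4p1 (R : realType) (p q r : nat)
    (hp : (0 < p)%N) (hq : (0 < q)%N) (hr : (0 < r)%N)
    (hlt : (q * r < p)%N) (hndvd : ~~ (q * r %| p)%N) :
  is_LSp_rank (MT R (complete_uniform p q) r) (p %/ (q * r))%N.
Proof.
pose E (s : 'I_#|matchings (complete_uniform p q) r|) := cover (enum_val s).
have -> : MT R (complete_uniform p q) r = packing E :> (_ -> Prop).
  have satE s v : saturates (enum_val s) v = (v \in E s).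
    by apply/exists_inP/bigcupP => -[e eS ve]; exists e.
  apply: funext => x; apply: propext; rewrite /MT /packing /=.
  have sumE v : \sum_(s | saturates (enum_val s) v) x s 0 = \sum_(s | v \in E s) x s 0.
    by apply: eq_bigl => s; rewrite satE.
  by split=> -[x01 xv]; split=> // v; have := xv v; rewrite sumE.
set m := (q * r)%N; have m_gt0 : (0 < m)%N by rewrite muln_gt0 hq hr.
have Em s : #|E s| = m by apply: card_cover_matching; apply: enum_valP.
have cE (T : {set 'I_p}) : #|[set s | E s == T]| = matching_count q r T.
  rewrite -(card_imset _ enum_val_inj); apply: eq_card => S.
  apply/imsetP/idP => [[s]|]; rewrite !inE.
    by move=> sT ->; move: (enum_valP s); rewrite inE => ->.
  move=> /andP[SG ST]; have SG' : S \in matchings (complete_uniform p q) r by rewrite inE.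
  by exists (enum_rank_in SG' S); rewrite ?inE /E enum_rankK_in.
have [|T0 _ T0m] := @exists_draw _ [set: 'I_p] m; first by rewrite cardsT card_ord ltnW.
(* The common multiplicity is read off at an arbitrary [m]-set, which exists because [q * r < p]. *)
pose N := matching_count q r T0.
have EN (T : {set 'I_p}) : #|T| = m -> #|[set s | E s == T]| = N.
  by move=> Tm; rewrite cE; apply: matching_count_const; rewrite Tm.
have N_gt0 : (0 < N)%N.
  have [S SG ST] := exists_matching hq T0m.
  by apply/card_gt0P; exists S; rewrite inE SG ST eqxx.
have := packing_LSp_rank R m_gt0 N_gt0 Em EN; rewrite card_ord.
by apply=> //; apply: ltnW.
Qed.
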